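(* Let $k\ge 2$ be an integer. There exists a set $A\subset \mathbb{N}_0$ such that $A^k + A = \mathbb{N}_0$ and, for some constant $C>0$ and all sufficiently large $X$, $$A(X) \le C\,\frac{\sqrt{X}}{(\log X)^{\alpha(k)}}, \qquad \text{where } \alpha(k) = \frac{k-2}{k+1}.$$
   Context: $\mathbb{N}_0$ is the set of nonnegative integers. For sets $A,B$ of integers, $AB=\{ab: a\in A, b\in B\}$, $A+B=\{a+b\}$, $A^1=A$ and $A^k = A A^{k-1}$ for $k>1$. For $A\subset\mathbb{N}_0$ and $X>0$, $A(X)=|A\cap[1,X]|$. *)

(* Defs.v *)
From Stdlib Require Import Reals Lra Lia Arith List.
Open Scope R_scope.

Fixpoint prodpow (A : nat -> bool) (k : nat) (n : nat) : Prop :=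
  match k with
  | O => False (* A^0 is not used *)
  | S O => A n = true
  | S k' => exists a b, A a = true /\ prodpow A k' b /\ n = (a * b)%nat
  end.

Definition sumset_covers (B : nat -> Prop) (A : nat -> bool) : Prop :=
  forall n : nat, exists b a, B b /\ A a = true /\ n = (b + a)%nat.

Fixpoint count_upto (A : nat -> bool) (N : nat) : nat :=
  match N with
  | O => O
  | S N' => (count_upto A N' + (if A (S N') then 1 else 0))%nat
  end.

Definition counting (A : nat -> bool) (X : R) : R :=
  INR (count_upto A (Z.to_nat (Int_part X))).

(* Main.v *)
(* Write alpha = (k - 2) / (k + 1). Choose k families ("colours") of integers,
   each with about 2^j / j^alpha members of size about 4^j for every j, such
   that every member is a power of 2 times its own odd prime. The products of
   one member of each colour are then pairwise distinct, and about
   sqrt X (log X)^(k - 1 - k alpha) of them lie below X. A greedy covering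
   argument (Lorentz's lemma) gives an additive complement of this set of
   products, with a loss of one logarithm: its counting function is at most
   about sqrt X log X / (log X)^(k - 1 - k alpha) = sqrt X / (log X)^alpha.
   The basis is the union of the colours, the complement and an initial
   segment. The only input on primes is that the m-th prime is O(m^2), from
   2^n <= binomial(2n, n) <= (2n)^pi(2n). *)
Require Import Defs.
From Stdlib Require Import Reals Lra Lia ZArith ClassicalEpsilon.
From mathcomp Require all_boot zify.

Open Scope R_scope.

Module ProductBasis.
Import mathcomp.boot.all_boot mathcomp.zify.zify.

Set Implicit Arguments.
Unset Strict Implicit.
Unset Printing Implicit Defensive.
Local Open Scope nat_scope.

(** * Odd primes *)

(** Passing from [n] to [n.+1] multiplies the central binomial by 2(2n+1)/(n+1), which is at least
    2. *)
Lemma leq_expn_central_bin n : 2 ^ n <= 'C(n.*2, n).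
Proof.
elim: n => [|n IHn]; first by rewrite bin0.
have E : n.+1 * 'C(n.+1.*2, n.+1) = 2 * (n.*2.+1 * 'C(n.*2, n)).
  rewrite -mul_bin_diag doubleS /= (_ : n.*2.+2 = 2 * n.+1); last by lia.
  by rewrite -mulnA (mul_bin_down n.*2.+1 n) /= (_ : n.*2.+1 - n = n.+1) //; lia.
by rewrite expnS; nia.
Qed.

(** By Legendre's formula the exponent of [p] is a sum of terms floor(2n/p^k) - 2 floor(n/p^k). Each
    is at most 1, and only the [t] values of [k] with p^k <= 2n contribute. *)
Lemma central_bin_pfactor_leq p n :
  prime p -> 0 < n -> p ^ logn p 'C(n.*2, n) <= n.*2.
Proof.
move=> pr_p n_gt0; have p_gt1 := prime_gt1 pr_p.
have ltt := trunc_log_ltn n.*2 p_gt1.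
have n2_gt0 : 0 < n.*2 by rewrite double_gt0.
have tle := trunc_logP p_gt1 n2_gt0.
set t := trunc_log p n.*2 in ltt tle.
suff le_t : logn p 'C(n.*2, n) <= t.
  by apply: leq_trans tle; rewrite leq_exp2l.
have E : n.*2`! = 'C(n.*2, n) * (n`! * n`!).
  rewrite -(@bin_fact n.*2 n); last by rewrite -addnn leq_addr.
  by rewrite -addnn addnK.
have lef : t <= n.*2.
  by apply: leq_trans tle; apply: ltnW; apply: ltn_expl.
(* Brings the three Legendre sums to the common range 1..t: terms beyond [t] vanish, and so do those
   added when [m] is below [t]. *)
have trunc_sum m : m <= n.*2 ->
    logn p m`! = \sum_(1 <= k < t.+1) m %/ p ^ k.
  move=> le_m; rewrite logn_fact //.
  have big_exp k : t < k -> m %/ p ^ k = 0.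
    move=> lt_tk; apply: divn_small; apply: leq_ltn_trans le_m _.
    by apply: leq_trans ltt _; rewrite leq_exp2l.
  have [le_mt|lt_tm] := leqP m t.
    rewrite (big_cat_nat (n := m.+1) (p := t.+1)) //= [X in _ + X]big1_seq ?addn0 //.
    move=> k /andP[_]; rewrite mem_index_iota => /andP[lt_mk _].
    by apply: divn_small; apply: leq_trans lt_mk _; apply: ltnW; apply: ltn_expl.
  rewrite (big_cat_nat (n := t.+1) (p := m.+1)) //= ?(leqW lt_tm) //.
  rewrite [X in _ + X]big1_seq ?addn0 //.
  by move=> k /andP[_]; rewrite mem_index_iota => /andP[/big_exp].
have C_gt0 : 0 < 'C(n.*2, n) by rewrite bin_gt0 -addnn leq_addr.
have := congr1 (logn p) E.
rewrite !lognM ?muln_gt0 ?fact_gt0 // !trunc_sum //; last by rewrite -addnn leq_addr.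
suff : \sum_(1 <= k < t.+1) n.*2 %/ p ^ k <=
       t + (\sum_(1 <= k < t.+1) n %/ p ^ k + \sum_(1 <= k < t.+1) n %/ p ^ k).
  by lia.
have tE : \sum_(1 <= k < t.+1) 1 = t by rewrite sum_nat_const_nat; lia.
rewrite -[X in _ <= X + _]tE -!big_split /=; apply: leq_sum => k _.
have q_gt0 : 0 < p ^ k by rewrite expn_gt0 ltnW.
rewrite -ltnS ltn_divLR //.
have := ltn_ceil n q_gt0.
by rewrite -addnn; nia.
Qed.

(** Every prime power in the factorisation of the binomial is at most 2n, hence so is every prime,
    and the product has at most pi(2n) factors. *)
Lemma leq_expn_prime_count n :
  0 < n -> 2 ^ n <= n.*2 ^ count prime (iota 0 n.*2.+1).
Proof.
move=> n_gt0; apply: leq_trans (leq_expn_central_bin n) _.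
have C_gt0 : 0 < 'C(n.*2, n) by rewrite bin_gt0 -addnn leq_addr.
rewrite {1}(prod_prime_decomp C_gt0) prime_decompE big_map /=.
apply: (@leq_trans (\prod_(p <- primes 'C(n.*2, n)) n.*2)).
  rewrite big_seq [X in _ <= X]big_seq; apply: leq_prod => p.
  rewrite mem_primes => /and3P[pr_p _ _]; exact: central_bin_pfactor_leq.
rewrite big_const_seq count_predT iter_muln_1 leq_pexp2l ?double_gt0 //.
rewrite -size_filter; apply: uniq_leq_size; first exact: primes_uniq.
move=> p; rewrite mem_primes mem_filter => /and3P[pr_p _ p_dv].
rewrite pr_p mem_iota /= ltnS.
have le_pC := central_bin_pfactor_leq pr_p n_gt0. rewrite prime_gt0 //=; apply: (leq_trans _ le_pC).
by rewrite -{1}(expn1 p) leq_exp2l ?prime_gt1 // logn_gt0 mem_primes pr_p C_gt0.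
Qed.

Definition odd_prime_seq N := [seq p <- iota 0 N | prime p & odd p].

(** The default 0 is never returned: by [size_odd_prime_seq] the list is long enough. *)
Definition nth_odd_prime m := nth 0 (odd_prime_seq (16 * m.+1 ^ 2).+1) m.

(** Otherwise, counting 2, there are at most m+1 primes up to 16(m+1)^2, and the previous bound at n
    = 8(m+1)^2 gives 2^(8(m+1)) <= 16(m+1)^2, whereas the right side is below 2^(4+2(m+1)). *)
Lemma size_odd_prime_seq m : m < size (odd_prime_seq (16 * m.+1 ^ 2).+1).
Proof.
rewrite ltnNge; apply/negP => le_m.
have := @leq_expn_prime_count (8 * m.+1 ^ 2) isT.
rewrite -mul2n mulnA (_ : 2 * 8 = 16) //.
have le_c : count prime (iota 0 (16 * m.+1 ^ 2).+1) <= m.+1.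
  rewrite (eq_count (a2 := predU (pred1 2) (fun p => prime p && odd p))); last first.
    move=> p /=; case: (boolP (p == 2)) => [/eqP->//|p2] /=.
    by case: (boolP (prime p)) => //= pr_p; case: (even_prime pr_p) p2 => [->|->].
  apply: leq_trans (leq_addr (count (predI (pred1 2)
    (fun p => prime p && odd p)) (iota 0 (16 * m.+1 ^ 2).+1)) _) _.
  rewrite count_predUI count_uniq_mem ?iota_uniq // -[m.+1]add1n.
  by rewrite -[X in _ + X]size_filter leq_add ?leq_b1.
apply/negP; rewrite -ltnNge.
apply: (@leq_ltn_trans ((16 * m.+1 ^ 2) ^ m.+1)); first by rewrite leq_pexp2l //; lia.
have -> : 8 * m.+1 ^ 2 = (8 * m.+1) * m.+1 by lia.
rewrite expnM ltn_exp2r //.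
apply: (@leq_trans (2 ^ 4 * (2 ^ m.+1) ^ 2)).
  by rewrite ltn_pmul2l // ltn_exp2r // ltn_expl.
by rewrite -expnM -expnD leq_exp2l //; lia.
Qed.

Lemma nth_odd_primeP m :
  [/\ prime (nth_odd_prime m), odd (nth_odd_prime m)
    & nth_odd_prime m <= 16 * m.+1 ^ 2].
Proof.
have := mem_nth 0 (size_odd_prime_seq m).
by rewrite -/(nth_odd_prime m) mem_filter mem_iota -andbA => /and4P[].
Qed.

Lemma nth_odd_prime_inj : injective nth_odd_prime.
Proof.
(* A shorter list is a prefix of a longer one, so both primes can be read off one duplicate-free
   list. *)
have ext a b : a <= b ->
    nth_odd_prime a = nth 0 (odd_prime_seq (16 * b.+1 ^ 2).+1) a.
  move=> le_ab; have -> : (16 * b.+1 ^ 2).+1 =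
      (16 * a.+1 ^ 2).+1 + (16 * b.+1 ^ 2 - 16 * a.+1 ^ 2) by nia.
  by rewrite /odd_prime_seq iotaD filter_cat nth_cat size_odd_prime_seq.
suff lt_neq a b : a < b -> nth_odd_prime a <> nth_odd_prime b.
  by move=> a b eq_ab; case: (ltngtP a b) => // /lt_neq; rewrite eq_ab.
move=> lt_ab; rewrite (ext a b) 1?ltnW // => /eqP.
have lt_b := size_odd_prime_seq b.
rewrite nth_uniq ?filter_uniq ?iota_uniq ?(ltn_trans lt_ab) //; lia.
Qed.

(** * Coloured families and their products *)

Section Family.

Variables (k : nat) (w : nat -> nat).
Hypothesis k_gt0 : 0 < k.
Hypothesis le_w : forall j, w j <= 2 ^ j.+1.

(** The index encodes the triple: its residue mod [k] is the colour, and for l < 2^(j+1) its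
    quotient lies in [2^(j+1), 2^(j+2)), which determines [j] and [l]. The prime is then O(4^j) for
    fixed [k]. *)
Definition colour_prime i j l := nth_odd_prime ((2 ^ j.+1 + l) * k + i).

(* The power of 2 pushes the element into (M / 2, M] for M = 4 ^ (j + k + 4)
   without affecting its only odd prime factor. *)
Definition elt i j l :=
  colour_prime i j l * 2 ^ trunc_log 2 (4 ^ (j + k + 4) %/ colour_prime i j l).

Definition level i j := [seq elt i j l | l <- iota 0 (w j)].

(** One factor is taken from each of the colours 0..i, with levels adding up to [J], so that all
    products have size about 4^J. *)
Fixpoint prods i J :=
  if i is i'.+1 then
    [seq x | j <- iota 0 J.+1,
             x <- [seq b * s | b <- prods i' (J - j), s <- level i'.+1 j]]
  else level 0 J.

Lemma colour_prime_inj i i' j j' l l' :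
  i < k -> i' < k -> l < 2 ^ j.+1 -> l' < 2 ^ j'.+1 ->
  colour_prime i j l = colour_prime i' j' l' -> [/\ i = i', j = j' & l = l'].
Proof.
move=> lt_i lt_i' lt_l lt_l' /nth_odd_prime_inj E.
have eq_i : i = i'.
  by have := congr1 (modn^~ k) E; rewrite /= !modnMDl !modn_small.
have eq_n : 2 ^ j.+1 + l = 2 ^ j'.+1 + l'.
  by have := congr1 (divn^~ k) E; rewrite /= !divnMDl // !divn_small // !addn0.
have eq_j : j = j'.
  apply: succn_inj; rewrite -(@trunc_log_eq 2 j.+1 (2 ^ j.+1 + l)) //.
    by rewrite eq_n; apply: trunc_log_eq => //; rewrite leq_addr (expnS 2 j'.+1); lia.
  by rewrite leq_addr (expnS 2 j.+1); lia.
by split => //; move: eq_n; rewrite eq_j; apply: addnI.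
Qed.

Lemma prime_colour_prime i j l : prime (colour_prime i j l).
Proof. by case: (nth_odd_primeP ((2 ^ j.+1 + l) * k + i)). Qed.

Lemma colour_prime_leq i j l :
  i < k -> l < 2 ^ j.+1 -> colour_prime i j l <= 4 ^ (j + k + 4).
Proof.
move=> lt_i lt_l.
have [_ _ le_p] := nth_odd_primeP ((2 ^ j.+1 + l) * k + i).
apply: leq_trans le_p _.
(* The index plus one is at most 2^(j+2) k <= 2^(j+2+k); squaring and multiplying by 16 gives
   exactly 4^(j+k+4). *)
apply: (@leq_trans (16 * (2 ^ j.+2 * 2 ^ k) ^ 2)).
  rewrite leq_pmul2l // leq_exp2r //.
  apply: (@leq_trans (2 ^ j.+2 * k)); first by rewrite (expnS 2 j.+1); nia.
  by apply: leq_mul => //; apply: ltnW; apply: ltn_expl.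
rewrite -[16]/(2 ^ 4) -[4 ^ _]/((2 ^ 2) ^ _) -expnD -!expnM -expnD leq_exp2l //; lia.
Qed.

(** A colour prime is odd, so it cannot divide the power of 2 and must equal the prime of the
    member. *)
Lemma dvdn_elt i i' j j' l l' :
  i < k -> i' < k -> l < 2 ^ j.+1 -> l' < 2 ^ j'.+1 ->
  colour_prime i j l %| elt i' j' l' -> [/\ i = i', j = j' & l = l'].
Proof.
move=> lt_i lt_i' lt_l lt_l'.
rewrite Euclid_dvdM ?prime_colour_prime // => /orP[|].
  rewrite dvdn_prime2 ?prime_colour_prime // => /eqP; exact: colour_prime_inj.
rewrite Euclid_dvdX ?prime_colour_prime // => /andP[dv2 _].
case: (nth_odd_primeP ((2 ^ j.+1 + l) * k + i)) => _.
move: dv2; rewrite dvdn_prime2 ?prime_colour_prime // /colour_prime => /eqP->.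
by [].
Qed.

Lemma elt_bounds i j l :
  i < k -> l < 2 ^ j.+1 -> 4 ^ j <= elt i j l <= 4 ^ (j + k + 4).
Proof.
move=> lt_i lt_l; rewrite /elt.
have := colour_prime_leq lt_i lt_l.
have := prime_gt0 (prime_colour_prime i j l).
move: (colour_prime i j l) => r r_gt0 le_r.
have q_gt0 : 0 < 4 ^ (j + k + 4) %/ r by rewrite divn_gt0.
have /andP[lo] := trunc_log_bounds (isT : 1 < 2) q_gt0.
move: lo; rewrite leq_divRL // ltn_divLR // mulnC expnS => lo hi.
have E : 4 ^ j * 4 <= 4 ^ (j + k + 4) by rewrite -expnSr leq_exp2l //; lia.
by apply/andP; split => //; nia.
Qed.

Lemma level_uniq i j : i < k -> uniq (level i j).
Proof.
move=> lt_i; rewrite map_inj_in_uniq ?iota_uniq // => l l'.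
rewrite !mem_iota /= !add0n => lt_l lt_l' E.
have lt_l2 := leq_trans lt_l (le_w j); have lt_l2' := leq_trans lt_l' (le_w j).
by have [] := @dvdn_elt i i j j l l' lt_i lt_i lt_l2 lt_l2'; rewrite // -E dvdn_mulr.
Qed.

Lemma levelP i j x : x \in level i j -> exists2 l, l < 2 ^ j.+1 & x = elt i j l.
Proof.
by case/mapP => l; rewrite mem_iota => lt_l ->; exists l => //; apply: leq_trans (le_w j).
Qed.

Lemma prodsSP i J x : x \in prods i.+1 J ->
  exists j b s, [/\ j <= J, b \in prods i (J - j), s \in level i.+1 j & x = b * s].
Proof.
case/allpairsPdep => j [y [+ + ->]]; rewrite mem_iota ltnS => le_j.
by case/allpairsP => [[b s] /= [b_in s_in ->]]; exists j, b, s.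
Qed.

Lemma prods_coprime i J x i' j' l' : i < i' < k -> l' < 2 ^ j'.+1 ->
  x \in prods i J -> ~~ (colour_prime i' j' l' %| x).
Proof.
move=> + lt_l'; have lev a j y : a < i' < k -> y \in level a j ->
    ~~ (colour_prime i' j' l' %| y).
  move=> /andP[lt_a lt_i'] /levelP[l lt_l ->]; apply/negP.
  by case/dvdn_elt => //; [apply: ltn_trans lt_i' | lia].
elim: i J x => [|i IHi] J x lt_i; first exact: lev.
case/prodsSP => j [b [s [_ b_in s_in ->]]].
rewrite Euclid_dvdM ?prime_colour_prime // negb_or (lev i.+1 j s) // andbT.
by apply: IHi b_in; lia.
Qed.

(** The prime of the last factor divides no product of earlier colours, so it identifies the level
    and index of that factor; cancelling it reduces to one colour fewer. *)
Lemma prods_uniq i J : i < k -> uniq (prods i J).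
Proof.
elim: i J => [|i IHi] J lt_i; first exact: level_uniq.
have inj j b s j' b' s' : b \in prods i (J - j) -> s \in level i.+1 j ->
    b' \in prods i (J - j') -> s' \in level i.+1 j' ->
    b * s = b' * s' -> j = j' /\ (b, s) = (b', s').
  move=> b_in /levelP[l lt_l ->] b'_in /levelP[l' lt_l' ->] E.
  have : colour_prime i.+1 j l %| b' * elt i.+1 j' l'.
    by rewrite -E dvdn_mull ?dvdn_mulr.
  rewrite Euclid_dvdM ?prime_colour_prime // (negPf (prods_coprime _ _ b'_in)) ?ltnSn //=.
  move=> /dvdn_elt[] // _ jj ll; move: E; rewrite -jj -ll => /eqP.
  rewrite eqn_pmul2r; first by move/eqP->.
  by have := elt_bounds lt_i lt_l; have := expn_gt0 4 j; lia.
apply: (@allpairs_uniq_dep nat (fun=> nat) nat (fun _ x => x)); first exact: iota_uniq.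
  move=> j _; apply: allpairs_uniq; rewrite ?(IHi _ (ltnW lt_i)) ?level_uniq //.
  move=> _ _ /allpairsP[[b s] /= [b_in s_in ->]] /allpairsP[[b' s'] /= [b'_in s'_in ->]] /= E.
  by have [] := inj _ _ _ _ _ _ b_in s_in b'_in s'_in E.
move=> [j x] [j' x'] /allpairsPdep[a [y [_ yin [-> ->]]]].
move=> /allpairsPdep[a' [y' [_ y'in [-> ->]]]] /= E.
case/allpairsP: yin E => [[b s] /= [b_in s_in ->]].
case/allpairsP: y'in => [[b' s'] /= [b'_in s'_in ->]] E.
by have [-> _] := inj _ _ _ _ _ _ b_in s_in b'_in s'_in E; rewrite E.
Qed.

(** The levels add up to [J], and each of the i+1 factors exceeds its 4^j by at most 4^(k+4). *)
Lemma prods_leq i J x : i < k -> x \in prods i J -> x <= 4 ^ (J + i.+1 * (k + 4)).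
Proof.
have lev a j y : a < k -> y \in level a j -> y <= 4 ^ (j + (k + 4)).
  by move=> lt_a /levelP[l lt_l ->]; case/andP: (elt_bounds lt_a lt_l); rewrite addnA.
elim: i J x => [|i IHi] J x lt_i; first by rewrite mul1n; apply: lev.
case/prodsSP => j [b [s [le_j b_in s_in ->]]].
have le_b := IHi _ _ (ltnW lt_i) b_in; have le_s := lev _ _ _ lt_i s_in.
apply: leq_trans (leq_mul le_b le_s) _.
by rewrite -expnD leq_exp2l //; lia.
Qed.

Lemma size_prodsS i J : size (prods i.+1 J) =
  \sum_(0 <= j < J.+1) size (prods i (J - j)) * w j.
Proof.
rewrite -[prods _ _]/(allpairs_dep (fun _ x => x) (iota 0 J.+1) (fun j =>
  [seq b * s | b <- prods i (J - j), s <- level i.+1 j])).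
rewrite size_allpairs_dep sumnE big_map /index_iota subn0; apply: eq_bigr => j _.
by rewrite size_allpairs size_map size_iota.
Qed.

Lemma prodpow_prods (A : nat -> bool) i J x :
  (forall i j y, i < k -> y \in level i j -> A y) ->
  i < k -> x \in prods i J -> prodpow A i.+1 x.
Proof.
move=> sub; elim: i J x => [|i IHi] J x lt_i; first exact: sub.
case/prodsSP => j [b [s [_ b_in s_in ->]]].
exists s, b; rewrite (sub _ _ _ lt_i s_in) mulnC; split=> //; split=> //.
by apply: IHi b_in; apply: ltnW.
Qed.

End Family.

(** * Greedy complements *)

Lemma sum_nat_seq_const (T : Type) (s : seq T) n : \sum_(x <- s) n = size s * n.
Proof. by rewrite big_const_seq count_predT iter_addn_0 mulnC. Qed.

Section Greedy.

Variables (T1 T2 : eqType) (e : T1 -> T2 -> bool) (V : seq T2) (d : nat).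
Hypothesis V_gt0 : 0 < size V.

(** Double counting of incidences: some element of [V] receives at least the average number. *)
Lemma popular_neighbour (U : seq T1) :
  {in U, forall x, d <= count (e x) V} ->
  exists2 c, c \in V & size U * d <= count (e^~ c) U * size V.
Proof.
move=> degU.
have [/hasP[c]|/hasPn nhas] :=
  boolP (has (fun c => size U * d <= count (e^~ c) U * size V) V); first by exists c.
have dbl : \sum_(c <- V) count (e^~ c) U = \sum_(x <- U) count (e x) V.
  under eq_bigr => c _ do rewrite -sum1_count big_mkcond.
  by rewrite exchange_big; apply: eq_bigr => x _; rewrite -sum1_count [RHS]big_mkcond.
have lo : size U * d <= \sum_(x <- U) count (e x) V.
  rewrite -sum_nat_seq_const big_seq [X in _ <= X]big_seq.
  by apply: leq_sum => x; apply: degU.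
have hi : \sum_(c <- V) (count (e^~ c) U * size V + 1) <= size V * (size U * d).
  rewrite -sum_nat_seq_const big_seq [X in _ <= X]big_seq.
  by apply: leq_sum => c /nhas; rewrite -ltnNge addn1.
move: hi; rewrite big_split -big_distrl /= dbl sum_nat_seq_const; nia.
Qed.

(** Each choice of a popular neighbour leaves at most the fraction 1 - d/|V| of the uncovered
    points; denominators are cleared to stay in the naturals. *)
Lemma greedy_cover (U : seq T1) t :
  {in U, forall x, d <= count (e x) V} ->
  exists C : seq T2, [/\ size C <= t, {subset C <= V} &
    size [seq x <- U | ~~ has (e x) C] * size V ^ t <= size U * (size V - d) ^ t].
Proof.
move=> degU; elim: t => [|t [C [le_C sub_C IH]]].
  by exists [::]; split=> //; rewrite !muln1 filter_predT.
set U' := [seq x <- U | _] in IH.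
have [c c_in le_c] : exists2 c, c \in V & size U' * d <= count (e^~ c) U' * size V.
  by apply: popular_neighbour => x; rewrite mem_filter => /andP[_ /degU].
exists (c :: C); split=> //; first by move=> y; rewrite inE => /predU1P[->|/sub_C].
have -> : [seq x <- U | ~~ has (e x) (c :: C)] = [seq x <- U' | ~~ e x c].
  by rewrite -filter_predI; apply: eq_filter => x /=; rewrite negb_or.
have E := count_predC (e^~ c) U'.
rewrite size_filter !expnS.
have -> : count (fun x => ~~ e x c) U' = size U' - count (e^~ c) U' by rewrite -E addKn.
rewrite [X in _ <= X]mulnCA.
apply: (@leq_trans ((size V - d) * (size U' * size V ^ t))); last by rewrite leq_mul2l IH orbT.
rewrite mulnA (mulnA _ (size U')) leq_mul2r; apply/orP; right.
by rewrite mulnBl mulnBl mulnC (mulnC d); apply: leq_sub2l.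
Qed.

End Greedy.

(** Targets lie in [2N, 8N) and candidates in [N, 8N). As [B] lies in [0, N], every n - b is a
    candidate, so each target has degree at least |B|. The numerical hypothesis makes the leftover
    count less than 1. *)
Lemma interval_cover (B : seq nat) N t :
  uniq B -> {in B, forall b, b <= N} -> 0 < N ->
  6 * N * (7 * N - size B) ^ t < (7 * N) ^ t ->
  exists C : seq nat, [/\ size C <= t, {in C, forall c, N <= c} &
    forall n, 2 * N <= n < 8 * N -> exists b c, [/\ b \in B, c \in C & n = b + c]].
Proof.
move=> uB leB N_gt0 small.
pose e n c := (c <= n) && (n - c \in B).
have [||C [le_C sub_C]] := @greedy_cover _ _ e (iota N (7 * N)) (size B) _ (iota (2 * N) (6 * N)) t.
- by rewrite size_iota; lia.
- move=> n; rewrite mem_iota => n_in; rewrite -(size_map (fun b => n - b)) -size_filter.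
  apply: uniq_leq_size.
    rewrite map_inj_in_uniq // => a b /leB le_a /leB le_b; lia.
  move=> _ /mapP[b b_in ->]; have le_b := leB _ b_in.
  rewrite mem_filter mem_iota /e subKn; last by lia.
  by rewrite b_in leq_subr /=; lia.
rewrite !size_iota => le_rest; exists C; split=> //.
  by move=> c /sub_C; rewrite mem_iota => /andP[].
move=> n n_in; have := leq_ltn_trans le_rest small.
case: (boolP (has (e n) C)) => [/hasP[c c_in /andP[le_cn nc_in]] _|nhas].
  by exists (n - c), c; split=> //; rewrite subnK.
rewrite ltnNge; case/negP; apply: leq_pmull.
rewrite size_filter -has_count; apply/hasP; exists n => //.
by rewrite mem_iota; lia.
Qed.

(** * Real estimates *)

Local Open Scope R_scope.

Lemma INRD m n : INR (m + n)%N = INR m + INR n. Proof. exact: plus_INR. Qed.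

Lemma INRM m n : INR (m * n)%N = INR m * INR n. Proof. exact: mult_INR. Qed.

Lemma INRX m n : INR (m ^ n)%N = INR m ^ n.
Proof. by elim: n => [|n IHn] //; rewrite expnS INRM IHn. Qed.

Lemma leq_INR m n : (m <= n)%N -> INR m <= INR n.
Proof. by move/leP; apply: le_INR. Qed.

Lemma INR_S_gt0 n : 0 < INR n.+1.
Proof. exact/lt_0_INR/ltP. Qed.

Lemma nat_ceil x : 0 <= x -> exists n, x <= INR n <= x + 1.
Proof.
move=> x_ge0; have [up_gt up_le] := archimed x.
have up_ge0 : (0 <= up x)%Z by apply: le_IZR; lra.
by exists (Z.to_nat (up x)); rewrite INR_IZR_INZ Z2Nat.id //; lra.
Qed.

(** A mean value bound on a unit step; summed over steps, it bounds a sum of [i]-th powers from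
    below in [size_prods_lower]. *)
Lemma pow_succ_diff x i : 0 <= x ->
  (x + 1) ^ i.+1 <= x ^ i.+1 + INR i.+1 * (x + 1) ^ i.
Proof.
move=> x_ge0; elim: i => [|i IHi]; first by rewrite /=; lra.
have h1 := pow_le x i.+1 x_ge0.
have h2 : x ^ i.+1 <= (x + 1) ^ i.+1 by apply: pow_incr; lra.
rewrite (S_INR i.+1) -[(x + 1) ^ i.+2]/((x + 1) * (x + 1) ^ i.+1).
rewrite -[x ^ i.+2]/(x * x ^ i.+1).
have -> : (INR i.+1 + 1) * (x + 1) ^ i.+1 =
  (x + 1) * (INR i.+1 * (x + 1) ^ i) + (x + 1) ^ i.+1.
  by rewrite -[(x + 1) ^ i.+1]/((x + 1) * (x + 1) ^ i); ring.
have := Rmult_le_compat_l (x + 1) _ _ (ltac:(lra)) IHi; lra.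
Qed.

Lemma Rpower_neg_anti a b c : 0 < a -> a <= b -> 0 <= c -> Rpower b (- c) <= Rpower a (- c).
Proof.
move=> a_gt0 le_ab c_ge0; rewrite !Rpower_Ropp.
apply: Rinv_le_contravar; first exact: exp_pos.
by apply: Rle_Rpower_l; lra.
Qed.

Lemma mul_Rpower_neg_mono a b c : 0 < a -> a <= b -> c <= 1 ->
  a * Rpower a (- c) <= b * Rpower b (- c).
Proof.
move=> a_gt0 le_ab c_le1.
rewrite -{1}(Rpower_1 a) // -{1}(Rpower_1 b); last by lra.
rewrite -!Rpower_plus; apply: Rle_Rpower_l; lra.
Qed.

Lemma ln_le_mono a b : 0 < a -> a <= b -> ln a <= ln b.
Proof. by move=> a_gt0 [/(ln_increasing _ _ a_gt0)/Rlt_le|->] //; apply: Rle_refl. Qed.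

Lemma exp_le_mono a b : a <= b -> exp a <= exp b.
Proof. by move=> [/exp_increasing/Rlt_le|->] //; apply: Rle_refl. Qed.

Lemma INR_S_le_pow2 n : INR n.+1 <= 2 ^ n.
Proof. by rewrite -[2]/(INR 2) -INRX; apply: leq_INR; apply: ltn_expl. Qed.

Section Weight.

Variable alpha : R.
Hypothesis alpha_ge0 : 0 <= alpha.
Hypothesis alpha_le1 : alpha <= 1.

(** At X = 4^J this is sqrt X / (log X)^alpha up to a constant; [J.+1] avoids a zero base. *)
Definition weight J := 2 ^ J * Rpower (INR J.+1) (- alpha).

(** Follows from J+1 <= 2^J and (J+1)^(1-alpha) >= 1. It lets rounding errors and constants be
    absorbed into the weight. *)
Lemma weight_ge1 J : 1 <= weight J.
Proof.
have y_gt0 := INR_S_gt0 J; have y_le := INR_S_le_pow2 J.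
have y_ge1 : 1 <= INR J.+1 by apply: (leq_INR (m := 1)).
have := mul_Rpower_neg_mono Rlt_0_1 y_ge1 alpha_le1.
rewrite {1}/Rpower ln_1 Rmult_0_r exp_0 /weight.
have : 0 < Rpower (INR J.+1) (- alpha) by exact: exp_pos.
nra.
Qed.

Lemma weight_le_pow2 J : weight J <= 2 ^ J.
Proof.
have y_ge1 : 1 <= INR J.+1 by apply: (leq_INR (m := 1)).
have := Rpower_neg_anti Rlt_0_1 y_ge1 alpha_ge0.
rewrite {2}/Rpower ln_1 Rmult_0_r exp_0 /weight.
have : 0 < 2 ^ J by apply: pow_lt; lra.
nra.
Qed.

(** The ratio of consecutive weights n and n+1 is at most (n+2)/(2(n+1)), hence at most 3/4 for n >=
    1, and 4 = 1/(1 - 3/4). The first two sums are checked directly. *)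
Lemma sum_weight_le J : sum_f_R0 weight J <= 4 * weight J.
Proof.
have step n : INR n.+1 * weight n <= INR n.+2 * weight n.+1 / 2.
  have := @mul_Rpower_neg_mono (INR n.+1) (INR n.+2) alpha.
  have -> // : weight n.+1 = 2 * (2 ^ n * Rpower (INR n.+2) (- alpha)).
    by rewrite /weight /=; ring.
  move=> /(_ (INR_S_gt0 n) (leq_INR (leqnSn _)) alpha_le1).
  have : 0 < 2 ^ n by apply: pow_lt; lra.
  by rewrite /weight; nra.
have w_ge1 := weight_ge1.
elim: J => [|[|J] IH]; rewrite [sum_f_R0 _ _]/=; first by have := w_ge1 0%N; lra.
  by have := step 0%N; have := w_ge1 0%N; have := w_ge1 1%N; rewrite /=; lra.
rewrite -[_ + weight J.+1]/(sum_f_R0 weight J.+1).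
have := step J.+1; have := w_ge1 J.+2; rewrite !S_INR => w2.
have := pos_INR J; have := w_ge1 J.+1; nra.
Qed.

End Weight.

(** Each new colour convolves the counts: the powers of 2 combine to 2^J, while summing [i]-th
    powers of J-j+1 gains a factor (J+1)/(i+1). Fixing [J0] keeps one [u] throughout the
    induction. *)
Lemma size_prods_lower k w u J0 i J :
  0 <= u -> (forall j, (j <= J0)%N -> u * 2 ^ j <= INR (w j)) -> (J <= J0)%N ->
  u ^ i.+1 * 2 ^ J * INR J.+1 ^ i <= INR (i`! * size (prods k w i J)).
Proof.
move=> u_ge0 le_w; elim: i J => [|i IHi] J le_J.
  by rewrite fact0 mul1n size_map size_iota /= !Rmult_1_r; apply: le_w.
(* Partial sums of the convolution, bounded by a telescoping difference of powers; m = J+1 is the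
   full sum. *)
have main m : (m <= J.+1)%N ->
    u ^ i.+2 * 2 ^ J * (INR J.+1 ^ i.+1 - INR (J.+1 - m) ^ i.+1) <=
    INR (i.+1)`! * INR (\sum_(0 <= j < m) size (prods k w i (J - j)) * w j).
  elim: m => [|m IHm] lt_m; first by rewrite big_geq // subn0 /=; lra.
  have le_mJ : (m <= J)%N by [].
  have -> : \sum_(0 <= j < m.+1) size (prods k w i (J - j)) * w j =
      (\sum_(0 <= j < m) size (prods k w i (J - j)) * w j +
       size (prods k w i (J - m)) * w m)%N by rewrite big_nat_recr.
  rewrite [INR (_ + _)%N]INRD [INR (size _ * _)]INRM.
  have := IHm (ltnW lt_m).
  have := IHi (J - m)%N (leq_trans (leq_subr _ _) le_J); rewrite INRM -subSn //.
  have := le_w m (leq_trans le_mJ le_J).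
  rewrite subSS (subSn le_mJ) (S_INR (J - m)).
  have -> : 2 ^ J = 2 ^ (J - m) * 2 ^ m by rewrite -{1}(subnK le_mJ); apply: Rdef_pow_add.
  have := @pow_succ_diff (INR (J - m)) i (pos_INR _).
  rewrite factS INRM.
  set z := INR (J - m); set a := INR i.+1; set s := INR (size _); set f := INR (i`!).
  set W := INR (w m); set p := 2 ^ (J - m); set q := 2 ^ m.
  set S := INR (\sum_(_ <= _ < _) _); set Y := INR J.+1 ^ i.+1.
  rewrite -[u ^ i.+2]/(u * u ^ i.+1).
  have: 0 <= u ^ i.+1 by apply: pow_le.
  have: 0 <= (z + 1) ^ i by apply: pow_le; have := pos_INR (J - m); rewrite -/z; lra.
  have: 0 < p by apply: pow_lt; lra.
  have: 0 < q by apply: pow_lt; lra.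
  have: 0 < a by exact: INR_S_gt0.
  move: (u ^ i.+1) ((z + 1) ^ i) ((z + 1) ^ i.+1) (z ^ i.+1) => U Z Z1 z1.
  move=> a_gt0 q_gt0 p_gt0 Z_ge0 U_ge0 diff hW hs hS.
  have hsW : (U * p * Z) * (u * q) <= (f * s) * W.
    apply: Rmult_le_compat => //; first by apply: Rmult_le_pos => //; nra.
    by nra.
  have := Rmult_le_compat_l a _ _ (Rlt_le _ _ a_gt0) hsW.
  have UU : 0 <= u * U * (p * q) by apply: Rmult_le_pos; nra.
  have := Rmult_le_compat_l _ _ _ UU diff; lra.
have := main J.+1 (leqnn _).
by rewrite subnn -size_prodsS INRM [INR 0]/= pow_i; [lra | apply/ltP].
Qed.

(** With M = 7N, f = |B| and [t] the rounded-up (M/f) ln M, (1 - f/M)^t <= exp(-tf/M) <= 1/M, and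
    6N/M = 6/7 < 1. *)
Lemma interval_cover_log (B : seq nat) N :
  uniq B -> {in B, forall b, (b <= N)%N} -> (0 < N)%N -> (0 < size B)%N ->
  exists C : seq nat, [/\
    INR (size C) <= 7 * INR N / INR (size B) * ln (7 * INR N) + 1,
    {in C, forall c, (N <= c)%N} &
    forall n, (2 * N <= n < 8 * N)%N ->
      exists b c, [/\ b \in B, c \in C & n = (b + c)%N]].
Proof.
move=> uB leB N_gt0 B_gt0.
have le_f : (size B <= 7 * N)%N.
  apply: (@leq_trans N.+1); last by lia.
  rewrite -(size_iota 0 N.+1); apply: uniq_leq_size => // b /leB.
  by rewrite mem_iota ltnS.
have f_gt0 : 0 < INR (size B) by exact/lt_0_INR/ltP.
have Nr_ge1 : 1 <= INR N by apply: (leq_INR (m := 1)).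
have le_fr : INR (size B) <= 7 * INR N.
  by have := leq_INR le_f; rewrite INRM [INR 7]INR_IZR_INZ.
have ln_ge0 : 0 <= ln (7 * INR N).
  by rewrite -ln_1; apply: ln_le_mono; lra.
have r_gt0 : 0 < 7 * INR N / INR (size B) by apply: Rdiv_lt_0_compat; lra.
have [|t [t_ge t_le]] := @nat_ceil (7 * INR N / INR (size B) * ln (7 * INR N)).
  by apply: Rmult_le_pos; lra.
have [|C [le_C geC coverC]] := @interval_cover B N t uB leB N_gt0.
  apply/ltP/INR_lt; rewrite !(INRM, INRX) [INR (_ - _)]minus_INR; last exact/leP.
  rewrite INRM [INR 7]INR_IZR_INZ [INR 6]INR_IZR_INZ.
  rewrite [IZR (Z.of_nat 7)]/= [IZR (Z.of_nat 6)]/=.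
  set M := 7 * INR N in le_fr ln_ge0 r_gt0 t_ge t_le *.
  set f := INR (size B) in f_gt0 le_fr r_gt0 t_ge t_le *.
  have M_gt0 : 0 < M by rewrite /M; lra.
  have le1 : (M - f) ^ t <= M ^ t * / M.
    have -> : M - f = M * (1 - f / M) by field; lra.
    rewrite Rpow_mult_distr; apply: Rmult_le_compat_l; first by apply: pow_le; lra.
    have x_le1 : f / M <= 1 by apply: Rmult_le_reg_r M_gt0 _; rewrite /Rdiv Rmult_assoc Rinv_l; lra.
    apply: (Rle_trans _ (exp (- (f / M)) ^ t)).
      apply: pow_incr; split; first by lra.
      by have := exp_ineq1_le (- (f / M)); lra.
    rewrite -Rpower_pow; last exact: exp_pos.
    rewrite /Rpower ln_exp -[/ M]exp_ln; last exact: Rinv_0_lt_compat.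
    rewrite ln_Rinv //; apply: exp_le_mono.
    have -> : ln M = f / M * (M / f * ln M) by field; lra.
    have : 0 < f / M by apply: Rdiv_lt_0_compat.
    by nra.
  have Mt : 0 < M ^ t by apply: pow_lt.
  apply: (Rle_lt_trans _ (6 * INR N * (M ^ t * / M))).
    by apply: Rmult_le_compat_l => //; lra.
  have -> : 6 * INR N * (M ^ t * / M) = M ^ t * (6 / 7) by rewrite /M; field; lra.
  by lra.
exists C; split=> //; apply: (Rle_trans _ (INR t)) => //; exact: leq_INR.
Qed.

(** * The basis *)

Lemma count_upto_leq (A : nat -> bool) N (s : seq nat) :
  (forall n, (n <= N)%N -> A n -> n \in s) -> (count_upto A N <= size s)%N.
Proof.
move=> sub; have -> : count_upto A N = count A (iota 1 N).
  elim: N {sub} => // N IHN; rewrite -{2}addn1 iotaD count_cat -IHN /= addn0 add1n.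
  by case: (A _).
rewrite -size_filter; apply: uniq_leq_size; first by rewrite filter_uniq ?iota_uniq.
by move=> n; rewrite mem_filter mem_iota add1n ltnS => /and3P[/[swap] _ An]; move/sub; apply.
Qed.

Lemma size_flatten_leq (F : nat -> seq nat) (g : nat -> R) c m :
  (forall j, INR (size (F j)) <= c * g j) ->
  INR (size (flatten [seq F j | j <- iota 0 m.+1])) <= c * sum_f_R0 g m.
Proof.
move=> leF; elim: m => [|m IHm]; first by rewrite /= cats0.
rewrite -[m.+2]addn1 iotaD map_cat flatten_cat size_cat INRD.
rewrite -[flatten (map _ (iota (0 + _) _))]/(F m.+1 ++ [::]) cats0.
rewrite -[sum_f_R0 g m.+1]/(sum_f_R0 g m + g m.+1).
by have := leF m.+1; lra.
Qed.

Lemma prodpow_0 (A : nat -> bool) k : A 0%N -> (0 < k)%N -> prodpow A k 0.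
Proof.
move=> A0; case: k => // k _; elim: k => [|k IHk] //.
by exists 0%N, 0%N.
Qed.

Lemma epsilon_choice (S T : Type) (P : S -> T -> Prop) :
  (forall x, exists y, P x y) -> exists f, forall x, P x (f x).
Proof.
move=> exP; exists (fun x => proj1_sig (constructive_indefinite_description _ (exP x))).
by move=> x; case: constructive_indefinite_description.
Qed.

Section Assembly.

Variables (k : nat) (alpha : R).
Hypothesis k_gt1 : (1 < k)%N.
Hypothesis alphaE : alpha = INR (k - 2) / INR (k + 1).

Let k_gt0 : (0 < k)%N := ltnW k_gt1.

Lemma alpha_bounds : 0 <= alpha <= 1.
Proof.
have k1 : 0 < INR (k + 1) by apply/lt_0_INR/ltP; rewrite addn1.
have le_k : INR (k - 2) <= INR (k + 1) by apply: leq_INR; lia.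
rewrite alphaE; split.
  by apply: Rmult_le_pos; [exact: pos_INR | apply/Rlt_le/Rinv_0_lt_compat].
by apply: (Rmult_le_reg_r (INR (k + 1))) => //; field_simplify; lra.
Qed.

Let alpha_ge0 := proj1 alpha_bounds.
Let alpha_le1 := proj2 alpha_bounds.

(** Rounding up costs at most a factor 2 because the weight is at least 1; the bound 2^(j+1) keeps
    the indices [l] in their dyadic block. *)
Lemma exists_weights : exists w : nat -> nat,
  forall j, (w j <= 2 ^ j.+1)%N /\ weight alpha j <= INR (w j) <= 2 * weight alpha j.
Proof.
suff ex j : exists n, (n <= 2 ^ j.+1)%N /\ weight alpha j <= INR n <= 2 * weight alpha j.
  exact: (epsilon_choice ex).
have w_ge1 := weight_ge1 alpha_le1 j.
have [|n n_in] := @nat_ceil (weight alpha j); first by lra.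
exists n; split; last by lra.
apply/leP/INR_le; rewrite INRX [INR 2]/= -[2 ^ j.+1]/(2 * 2 ^ j).
have := weight_le_pow2 alpha_ge0 j; lra.
Qed.

(** This is the bound of [prods_leq] for all [k] colours. It is multiplied by 4 from one [J] to the
    next, so the windows from 2 [scale J] to 8 [scale J] abut. *)
Let scale J := (4 ^ (J + k * (k + 4)))%N.

Lemma ln_scale J :
  ln (7 * INR (scale J)) <= INR (3 * (k * (k + 4)).+3) * INR J.+1.
Proof.
rewrite /scale; move: (k * (k + 4))%N => e.
have ln2_le : ln 2 <= 1.
  rewrite -[1]ln_exp; apply: ln_le_mono; first by lra.
  by have := exp_ineq1_le 1; lra.
(* Uses 7 <= 2^3; with ln 2 <= 1 the exponent itself bounds the logarithm. *)
apply: (Rle_trans _ (ln (2 ^ (2 * (J + e) + 3)%N))).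
  apply: ln_le_mono; first by rewrite INRX; have := @pow_lt (INR 4) (J + e); rewrite [INR 4]/=; lra.
  rewrite -[2]/(INR 2) -INRX -[7](INR_IZR_INZ 7) -INRM; apply: leq_INR.
  by rewrite (expnD 2) expnM mulnC; apply: leq_mul.
rewrite ln_pow; last by lra.
apply: (Rle_trans _ (INR (2 * (J + e) + 3))).
  by have := pos_INR (2 * (J + e) + 3); nra.
by rewrite -INRM; apply: leq_INR; nia.
Qed.

(** For y = J+1 and u = y^(-alpha), there are at least a constant times u^k 2^J y^(k-1) products, so
    covering a window of length about 4^J costs about 2^J y / (u^k y^(k-1)) = 2^J u. *)
Lemma exists_complement w :
  (forall j, (w j <= 2 ^ j.+1)%N) -> (forall j, weight alpha j <= INR (w j)) ->
  exists c : R, 0 <= c /\ forall J, exists C : seq nat, [/\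
    INR (size C) <= c * weight alpha J, {in C, forall x, (scale J <= x)%N} &
    forall n, (2 * scale J <= n < 8 * scale J)%N ->
      exists b x, [/\ b \in prods k w k.-1 J, x \in C & n = (b + x)%N]].
Proof.
move=> le_w ge_w.
set D := INR (3 * (k * (k + 4)).+3).
have D_ge0 : 0 <= D by exact: pos_INR.
set E := INR (4 ^ (k * (k + 4))).
have E_ge0 : 0 <= E by exact: pos_INR.
set f0 := INR (k.-1)`!.
have f0_gt0 : 0 < f0 by apply/lt_0_INR/ltP; exact: fact_gt0.
have c_ge0 : 0 <= 7 * E * f0 * D by repeat apply: Rmult_le_pos; lra.
(* 7E comes from 7 [scale J] = 7E 4^J, [D] from its logarithm, [f0] from the factorial in the lower
   bound on products, and 1 from rounding up [t]. *)
exists (7 * E * f0 * D + 1); split=> [|J]; first by lra.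
set y := INR J.+1; have y_gt0 : 0 < y by exact: INR_S_gt0.
(* The smallest of the factors (j+1)^(-alpha) with j <= J, hence valid at every level involved. *)
set u := Rpower y (- alpha); have u_gt0 : 0 < u by exact: exp_pos.
have p_gt0 : 0 < 2 ^ J by apply: pow_lt; lra.
have low : u ^ k * 2 ^ J * y ^ k.-1 <= f0 * INR (size (prods k w k.-1 J)).
  rewrite -INRM -{1}(prednK k_gt0); apply: (@size_prods_lower _ _ _ J) => //; first by lra.
  move=> j le_j; apply: Rle_trans (ge_w j); rewrite Rmult_comm.
  apply: Rmult_le_compat_l; first by apply: pow_le; lra.
  by apply: Rpower_neg_anti => //; [exact: INR_S_gt0 | exact: leq_INR].
have uk_gt0 : 0 < u ^ k by apply: pow_lt.
have yk_gt0 : 0 < y ^ k.-1 by apply: pow_lt.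
set f := INR (size _) in low.
have f_gt0 : 0 < f.
  apply: (Rmult_lt_reg_l f0) => //; rewrite Rmult_0_r; apply: Rlt_le_trans low.
  by repeat apply: Rmult_lt_0_compat.
have lt_k : (k.-1 < k)%N by rewrite prednK.
have B_gt0 : (0 < size (prods k w k.-1 J))%N by apply/ltP/INR_lt.
have leB : {in prods k w k.-1 J, forall b, (b <= scale J)%N}.
  by move=> b /(prods_leq k_gt0 le_w lt_k); rewrite prednK.
have [|C [le_C geC coverC]] :=
    interval_cover_log (prods_uniq k_gt0 le_w J lt_k) leB _ B_gt0.
  by rewrite /scale expn_gt0.
exists C; split=> //; apply: Rle_trans le_C _.
rewrite Rmult_plus_distr_r Rmult_1_l; apply: Rplus_le_compat; last exact: weight_ge1.
rewrite -/f; have := ln_scale J; rewrite -/D -/y => ln_le.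
have scaleE : INR (scale J) = E * (2 ^ J * 2 ^ J).
  rewrite /scale addnC expnD INRM -/E; congr (_ * _).
  by rewrite INRX -Rpow_mult_distr; congr (_ ^ _); rewrite /=; ring.
(* [alpha * (k + 1) = k - 2] balances the two halves of the basis. *)
have balance : u * (u ^ k * y ^ k.-1) = y.
  rewrite -!Rpower_pow // /u !Rpower_mult -!Rpower_plus -[RHS]Rpower_1 //.
  congr (Rpower _ _).
  have -> : INR k.-1 = INR k - 1 by rewrite -{2}(prednK k_gt0) S_INR; ring.
  rewrite alphaE INRD [INR 1]/= [INR (k - 2)]minus_INR; last exact/leP.
  have := pos_INR k; rewrite [INR 2]/= => k_ge0; field; lra.
apply: (Rmult_le_reg_r f) => //.
have -> : 7 * INR (scale J) / f * ln (7 * INR (scale J)) * f =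
          7 * INR (scale J) * ln (7 * INR (scale J)) by field; lra.
rewrite scaleE in ln_le *.
apply: (Rle_trans _ (7 * (E * (2 ^ J * 2 ^ J)) * (D * y))).
  by apply: Rmult_le_compat_l => //; repeat apply: Rmult_le_pos; lra.
rewrite /weight -/y -/u -{1}balance.
have : 0 <= 7 * E * D * 2 ^ J * u by repeat apply: Rmult_le_pos; lra.
move/Rmult_le_compat_l => /(_ _ _ low); lra.
Qed.

Lemma exists_thin_basis : exists A : nat -> bool,
  sumset_covers (prodpow A k) A /\
  exists c : R, 0 < c /\ forall m x, (x < 4 ^ m.+1)%N ->
    INR (count_upto A x) <= c * weight alpha m.
Proof.
have [w w_prop] := exists_weights.
have le_w j : (w j <= 2 ^ j.+1)%N by case: (w_prop j).
have ge_w j : weight alpha j <= INR (w j) by case: (w_prop j) => _ [].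
have [c [c_ge0 exC]] := exists_complement le_w ge_w.
have [C C_prop] := epsilon_choice exC.
(* The initial segment ends where the window of level 0 begins. *)
pose N0 := (2 * scale 0)%N.
pose block j := flatten [seq level k w i j | i <- iota 0 k] ++ C j.
pose inA n := (n < N0)%N \/ exists j, n \in block j.
pose A n := if excluded_middle_informative (inA n) then true else false.
have AP n : A n <-> inA n by rewrite /A; case: excluded_middle_informative.
have scale_gt0 j : (0 < scale j)%N by rewrite /scale expn_gt0.
have A_level i j y : (i < k)%N -> y \in level k w i j -> A y.
  move=> lt_i y_in; apply/AP; right; exists j; rewrite mem_cat; apply/orP; left.
  by apply/flattenP; exists (level k w i j) => //; apply: map_f; rewrite mem_iota.
exists A; split.
  move=> n; have [lt_n|le_n] := ltnP n N0.
    (* Since 0 lies in [A], it is itself a [k]-fold product, and [n] is written as 0 + n. *)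
    exists 0%N, n; split; last by split=> //; apply/AP; left.
    by apply: prodpow_0 => //; apply/AP; left; rewrite /N0 muln_gt0 scale_gt0.
  (* The level whose window contains [n]: 4^J N0 <= n < 4^(J+1) N0. *)
  pose J := trunc_log 4 (n %/ N0).
  have N0_gt0 : (0 < N0)%N by rewrite /N0 muln_gt0 scale_gt0.
  have q_gt0 : (0 < n %/ N0)%N by rewrite divn_gt0.
  have /andP[] := trunc_log_bounds (isT : (1 < 4)%N) q_gt0.
  rewrite -/J leq_divRL // ltn_divLR // => lo hi.
  have scaleJ : scale J = (4 ^ J * scale 0)%N by rewrite /scale expnD add0n.
  have [|b [x [b_in x_in ->]]] := (let: And3 _ _ h := C_prop J in h) n.
    by rewrite scaleJ; move: lo hi; rewrite /N0 expnS; nia.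
  exists b, x; split; last first.
    by split=> //; apply/AP; right; exists J; rewrite mem_cat x_in orbT.
  by rewrite -(prednK k_gt0); apply: prodpow_prods b_in; rewrite ?prednK.
(* Ensures that only blocks 0..m meet the integers below 4^(m+1). *)
have block_ge j n : n \in block j -> (4 ^ j <= n)%N.
  rewrite mem_cat => /orP[/flattenP[s /mapP[i + ->]]|].
    rewrite mem_iota => lt_i /(levelP le_w)[l lt_l ->].
    by case/andP: (elt_bounds k_gt0 lt_i lt_l).
  case: (C_prop j) => _ geC _ /geC; apply: leq_trans.
  by rewrite leq_exp2l // leq_addr.
have size_block j : INR (size (block j)) <= (2 * INR k + c) * weight alpha j.
  have -> : size (block j) = (k * w j + size (C j))%N.
    rewrite size_cat size_flatten /shape -map_comp; congr (_ + _)%N.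
    rewrite -{3}(size_iota 0 k); elim: (iota 0 k) => //= i s ->.
    by rewrite size_map size_iota.
  rewrite INRD INRM; case: (C_prop j) => le_C _ _; case: (w_prop j) => _ [_].
  by have := pos_INR k; nra.
(* [N0] pays for the initial segment, 2k for the [k] colours, [c] for the complement, and 4 for
   summing over levels; the added 1 gives positivity. *)
exists (INR N0 + 4 * (2 * INR k + c) + 1); split.
  by have := pos_INR N0; have := pos_INR k; lra.
move=> m x lt_x.
have : (count_upto A x <= size (iota 0 N0 ++ flatten [seq block j | j <- iota 0 m.+1]))%N.
  apply: count_upto_leq => n le_n /AP[lt_n|[j n_in]]; rewrite mem_cat.
    by rewrite mem_iota lt_n.
  apply/orP; right; apply/flattenP; exists (block j) => //; apply: map_f.
  rewrite mem_iota /= -(@ltn_exp2l 4) //.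
  by apply: leq_ltn_trans (block_ge _ _ n_in) (leq_ltn_trans le_n lt_x).
move/leq_INR; rewrite size_cat size_iota INRD.
have := size_flatten_leq m size_block.
have := sum_weight_le alpha_ge0 alpha_le1 m; have := weight_ge1 alpha_le1 m.
have := pos_INR N0; have := pos_INR k.
set S := sum_f_R0 _ _; set W := weight _ _; set F := INR (size _) => k_ge0 N_ge0 W_ge1 le_S le_F.
have : (2 * INR k + c) * S <= (2 * INR k + c) * (4 * W) by apply: Rmult_le_compat_l; lra.
nra.
Qed.

(** Here 2^m <= sqrt X and ln X <= 2(m+1); doubling the base of the power -alpha loses at most a
    factor 2 because alpha <= 1. *)
Lemma weight_le_sqrt m X : 4 ^ m <= X < 4 ^ m.+1 -> 4 <= X ->
  weight alpha m <= 2 * (sqrt X / Rpower (ln X) alpha).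
Proof.
move=> [lo hi] X_ge4.
have p_gt0 : 0 < 2 ^ m by apply: pow_lt; lra.
have le_sqrt : 2 ^ m <= sqrt X.
  rewrite -(sqrt_square (2 ^ m)); last by lra.
  apply: sqrt_le_1_alt; rewrite -Rpow_mult_distr.
  by have -> : 2 * 2 = 4 by ring.
have ln_gt0 : 0 < ln X by rewrite -ln_1; apply: ln_increasing; lra.
have ln_le : ln X <= 2 * INR m.+1.
  apply: (Rle_trans _ (ln (4 ^ m.+1))); first by apply: ln_le_mono; lra.
  rewrite ln_pow; last by lra.
  have : ln 4 <= 2.
    have -> : 4 = 2 * 2 by ring.
    rewrite ln_mult; try lra.
    have : ln 2 <= 1 by rewrite -[1]ln_exp; apply: ln_le_mono; [lra | have := exp_ineq1_le 1; lra].
    by lra.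
  by have := INR_S_gt0 m; nra.
have y_gt0 := INR_S_gt0 m.
have h1 : Rpower (2 * INR m.+1) (- alpha) <= Rpower (ln X) (- alpha).
  exact: Rpower_neg_anti.
have h2 : INR m.+1 * Rpower (INR m.+1) (- alpha) <=
          2 * INR m.+1 * Rpower (2 * INR m.+1) (- alpha).
  by apply: mul_Rpower_neg_mono => //; lra.
have h3 : Rpower (INR m.+1) (- alpha) <= 2 * Rpower (ln X) (- alpha) by nra.
rewrite /weight /Rdiv -Rpower_Ropp.
have := exp_pos (- alpha * ln (ln X)); rewrite -/(Rpower (ln X) (- alpha)).
have := exp_pos (- alpha * ln (INR m.+1)); rewrite -/(Rpower (INR m.+1) (- alpha)).
nra.
Qed.

End Assembly.

Lemma exists_thin_product_basis k : (2 <= k)%coq_nat ->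
  exists A : nat -> bool,
    sumset_covers (prodpow A k) A /\
    exists C : R, C > 0 /\
      exists X0 : R, forall X : R, X >= X0 ->
        counting A X <=
          C * sqrt X / Rpower (ln X) (INR (k - 2) / INR (k + 1)).
Proof.
move=> /leP k_gt1; have [A [coverA [c [c_gt0 countA]]]] := exists_thin_basis k_gt1 erefl.
exists A; split=> //; exists (c * 2); split; first by lra.
exists 4 => X /Rge_le X_ge4; rewrite /counting.
have [fl_le fl_gt] := base_Int_part X.
have fl_ge0 : (0 <= Int_part X)%Z by apply: le_IZR; apply/Rlt_le/(Rplus_lt_reg_r (- X)); lra.
set x := Z.to_nat _.
have xE : INR x = IZR (Int_part X) by rewrite INR_IZR_INZ Z2Nat.id.
have x_gt0 : (0 < x)%N by apply/ltP/INR_lt; rewrite [INR 0]/=; lra.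
have /andP[lo hi] := trunc_log_bounds (isT : (1 < 4)%N) x_gt0.
set m := trunc_log 4 x in lo hi.
have four : INR 4 = 4 by rewrite INR_IZR_INZ.
(* The strict integer bound gives x+1 <= 4^(m+1), which carries over to the real [X] below x+1. *)
have := leq_INR lo; have := leq_INR hi; rewrite S_INR !INRX four => hiR loR.
apply: Rle_trans (countA m x hi) _.
have := @weight_le_sqrt k _ k_gt1 erefl m X; rewrite /Rdiv !Rmult_assoc => le_w.
by apply: Rmult_le_compat_l; [lra | apply: le_w; lra].
Qed.

End ProductBasis.

Theorem theorem1p2 (k : nat) (hk : (2 <= k)%nat) :
  exists A : nat -> bool,
    sumset_covers (prodpow A k) A /\
    exists C : R, C > 0 /\
      exists X0 : R, forall X : R, X >= X0 ->
        counting A X <=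
          C * sqrt X / Rpower (ln X) (INR (k - 2) / INR (k + 1)).
Proof. exact (ProductBasis.exists_thin_product_basis hk). Qed.
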